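(* Let $T,S\in\mathcal{B}_A(\mathcal{H})$. Then, for each choice of sign, $$w_A(TS\pm ST)\leq 2\sqrt{2}\,\|S\|_A\sqrt{w_A^2(T)-\frac{\big|\,\|\mathrm{Re}_A(T)\|_A^2-\|\mathrm{Im}_A(T)\|_A^2\,\big|}{2}}$$ and $$w_A(T^2)\leq \sqrt{2}\,\|T\|_A\sqrt{w_A^2(T)-\frac{\big|\,\|\mathrm{Re}_A(T)\|_A^2-\|\mathrm{Im}_A(T)\|_A^2\,\big|}{2}}.$$
   Context: $(\mathcal{H},\langle\cdot,\cdot\rangle)$ is a complex Hilbert space, $\mathcal{B}(\mathcal{H})$ is the algebra of bounded linear operators on $\mathcal{H}$, and $A\in\mathcal{B}(\mathcal{H})$ is a fixed positive operator ($\langle Ax,x\rangle\ge 0$ for all $x$). Put $\langle x,y\rangle_A=\langle Ax,y\rangle$ and $\|x\|_A=\sqrt{\langle x,x\rangle_A}$ (a seminorm). $\mathcal{B}_A(\mathcal{H})=\{T\in\mathcal{B}(\mathcal{H}): \mathrm{ran}(T^*A)\subseteq \mathrm{ran}(A)\}$, equivalently the set of $T$ for which some $S\in\mathcal{B}(\mathcal{H})$ satisfies $AS=T^*A$. For $T\in\mathcal{B}_A(\mathcal{H})$, $T^{\sharp_A}$ is the reduced solution of $AX=T^*A$, i.e. the unique $X\in\mathcal{B}(\mathcal{H})$ with $AX=T^*A$ and $\mathrm{ran}(X)\subseteq\overline{\mathrm{ran}(A)}$ (equivalently $T^{\sharp_A}=A^{\dagger}T^*A$, with $A^\dagger$ the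 Moore–Penrose inverse). Also $\mathrm{Re}_A(T)=\frac12(T+T^{\sharp_A})$, $\mathrm{Im}_A(T)=\frac1{2i}(T-T^{\sharp_A})$; the $A$-operator seminorm is $\|T\|_A=\sup\{\|Tx\|_A: x\in\mathcal{H},\ \|x\|_A=1\}$ and the $A$-numerical radius is $w_A(T)=\sup\{|\langle Tx,x\rangle_A|: x\in\mathcal{H},\ \|x\|_A=1\}$; $w_A^2(T)=(w_A(T))^2$. *)

(* Defs.v *)
From HB Require Import structures.
From mathcomp Require Import all_boot all_order all_algebra.
From mathcomp Require Import all_classical all_reals all_analysis.
From mathcomp Require Import complex.

Set Implicit Arguments.
Unset Strict Implicit.
Unset Printing Implicit Defensive.

Import Order.TTheory GRing.Theory Num.Theory.
Import numFieldNormedType.Exports.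
Local Open Scope classical_set_scope.
Local Open Scope complex_scope.
Local Open Scope ring_scope.

(* [inner] is linear in its first argument and conjugate-linear in the second;
   completeness refers to the norm, which [inner_normE] ties to [inner]. *)
HB.mixin Record CompleteNormedModule_isHilbert (R : realType) H
    of CompleteNormedModule R[i] H := {
  inner : {dot H for (@Num.conj R[i])} ;
  inner_normE : forall x : H, `|x| ^+ 2 = inner x x
}.

#[short(type="hilbertType")]
HB.structure Definition Hilbert (R : realType) :=
  {H of CompleteNormedModule_isHilbert R H & CompleteNormedModule R[i] H}.

Section SemiHilbertian.
Variables (R : realType) (H : hilbertType R).
Implicit Types (A T S X : H -> H) (x y : H).

Definition inn x y : R[i] := inner x y.

Definition bounded_operator : set (H -> H) :=
  [set T | linear T /\ exists M : R, forall x, `|T x| <= M%:C * `|x|].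

(* On R[i], [0 <= z] means that z is real and nonnegative. *)
Definition positive_operator : set (H -> H) :=
  [set A | bounded_operator A /\ forall x, 0 <= inn (A x) x].

(* The Hilbert space adjoint: for a bounded operator T there is exactly one
   bounded operator in the set below. *)
Definition adjoint T : H -> H :=
  get [set S | bounded_operator S /\ forall x y, inn (T x) y = inn x (S y)].

Definition innA A x y : R[i] := inn (A x) y.

(* [innA A x x] is a nonnegative real when A is positive. *)
Definition normA A x : R := Num.sqrt (complex.Re (innA A x x)).

Definition BA A : set (H -> H) :=
  [set T | bounded_operator T /\ range (adjoint T \o A) `<=` range A].

(* The reduced solution of A X = T^* A: for T in [BA A] there is exactly one
   operator in the set below. *)
Definition sharpA A T : H -> H :=
  get [set X | [/\ bounded_operator X, A \o X = adjoint T \o A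
                 & range X `<=` closure (range A)]].

Definition ReA A T : H -> H := 2^-1 *: (T + sharpA A T).

Definition ImA A T : H -> H := (2 * 'i%C)^-1 *: (T - sharpA A T).

(* The suprema of [opnormA] and [wA] are taken in R, where [sup] is 0 on an
   empty set (A = 0) and on an unbounded one; for T in [BA A] both sets are
   bounded. *)
Definition opnormA A T : R := sup [set normA A (T x) | x in [set x | normA A x = 1]].

(* The modulus lives in R[i], hence the projection to R. *)
Definition wA A T : R :=
  sup [set complex.Re `|innA A (T x) x| | x in [set x | normA A x = 1]].

End SemiHilbertian.

(* Main.v *)
Require Import Defs.
From HB Require Import structures.
From mathcomp Require Import all_boot all_order all_algebra.
From mathcomp Require Import all_classical all_reals all_analysis.
From mathcomp Require Import complex ring lra.

Set Implicit Arguments.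
Unset Strict Implicit.
Unset Printing Implicit Defensive.

Import Order.TTheory GRing.Theory Num.Theory.
Import numFieldNormedType.Exports.
Local Open Scope ring_scope.

Local Notation "x %:C" := (real_complex _ x) : ring_scope.

(** Why the inequalities hold.  Write [<x, y>_A = <A x, y>], let [X] be the reduced
    solution of [A X = T^* A], and put [B = Re_A T], [C = Im_A T].  For a vector
    [x] of seminorm 1, [<T S x, x>_A = <S x, X x>_A], so Cauchy-Schwarz gives

      [|<(T S + e S T) x, x>_A| <= ||S||_A (||T x||_A + ||X x||_A)], [|e| = 1],

    and the parallelogram law turns [||T x||^2 + ||X x||^2] into
    [2 (||B x||^2 + ||C x||^2)].  Hence the left-hand side is at most
    [2 ||S||_A sqrt (||B||^2 + ||C||^2)].  Finally
    [||B||^2 + ||C||^2 = 2 max (||B||^2, ||C||^2) - | ||B||^2 - ||C||^2 |], and both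
    [||B||_A] and [||C||_A] are at most [w_A(T)] because [B] and [C] are symmetric
    for [<., .>_A] and their quadratic forms are the real and imaginary parts of
    [<T x, x>_A].  This is [commutator_bound].  The bound on [w_A(T^2)] is the case
    [S = T], since [T T + T T = 2 T^2].

    The rest of the work shows that the objects in that argument exist and that
    the suprema are finite.
    - Projection onto closed subspaces gives the Riesz representation theorem
      and from it the Hilbert space adjoint ([adjointP]).
    - [X] is found by projecting any solution [y] of [A y = T^* A x] onto the
      closure of the range of [A]; its boundedness follows from the uniform
      boundedness principle in the form that weakly bounded sets are bounded
      ([weakly_bounded_bounded], [sharpA_spec]).
    - [T] is bounded for the seminorm: [X T] is symmetric for [<., .>_A] and
      norm-bounded, and such an operator is also bounded for the seminorm, by
      comparing the growth of its powers in the two senses ([krein_lax],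
      [BA_bounded_normA]). *)

(** * The modulus of a complex number as a real number *)

Section ComplexNumbers.
Variable R : realType.
Implicit Types z : R[i].

(** The norm of [R[i]] takes its values in [R[i]]; all estimates below are
    between elements of [R]. *)
Definition cabs z : R := complex.Re `|z|.

Lemma cabsE z : `|z| = (cabs z)%:C.
Proof. by rewrite /cabs RRe_real. Qed.

Lemma cabs_ge0 z : 0 <= cabs z.
Proof. by rewrite -ler0c -cabsE. Qed.

Lemma cabsM z1 z2 : cabs (z1 * z2) = cabs z1 * cabs z2.
Proof. by apply: complexI; rewrite -cabsE normrM !cabsE rmorphM. Qed.

Lemma cabsD z1 z2 : cabs (z1 + z2) <= cabs z1 + cabs z2.
Proof. by rewrite -lecR rmorphD /= -!cabsE ler_normD. Qed.

Lemma cabsN z : cabs (- z) = cabs z.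
Proof. by rewrite /cabs normrN. Qed.

Lemma cabsJ z : cabs (z^*) = cabs z.
Proof. by rewrite /cabs norm_conjC. Qed.

Lemma cabsC (r : R) : cabs r%:C = `|r|.
Proof. by rewrite /cabs normc_def /= expr0n addr0 sqrtr_sqr. Qed.

Lemma cabs_sqr z : z * z^* = (cabs z ^+ 2)%:C.
Proof. by rewrite -normCK cabsE rmorphXn. Qed.

Lemma conjMC (r : R) z : (r%:C * z)^* = r%:C * z^*.
Proof. by rewrite rmorphM /=; congr (_ * _); exact: conjc_real. Qed.

Lemma Re_le_cabs z : `|complex.Re z| <= cabs z.
Proof. by rewrite -lecR -cabsE normc_ge_Re. Qed.

Lemma ReC (r : R) : complex.Re r%:C = r. Proof. by []. Qed.

Lemma ReD z1 z2 : complex.Re (z1 + z2) = complex.Re z1 + complex.Re z2.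
Proof. by case: z1 z2 => [? ?] [? ?]. Qed.

Lemma ReN z : complex.Re (- z) = - complex.Re z.
Proof. by case: z. Qed.

Lemma ReJ z : complex.Re z^* = complex.Re z.
Proof. by case: z. Qed.

Lemma ReMC (r : R) z : complex.Re (r%:C * z) = r * complex.Re z.
Proof. by case: z => a b /=; rewrite mul0r subr0. Qed.

Lemma half_realC : 2^-1 = (2^-1)%:C :> R[i].
Proof. by rewrite fmorphV rmorph_nat. Qed.

Lemma invi : ('i%C)^-1 = - 'i%C :> R[i].
Proof. by apply: mulr1_eq; rewrite mulrN -expr2 sqr_i opprK. Qed.

Lemma cabsi : cabs 'i%C = 1 :> R.
Proof. by rewrite /cabs normc_def /= expr0n expr1n add0r sqrtr1. Qed.

End ComplexNumbers.

(** * Semi-inner products *)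

(** The discriminant of a quadratic in [t] that is nowhere negative, for the
    quadratics that appear when a vector is perturbed by [t <x, y> y]: [n] is the
    squared modulus of [<x, y>], so the discriminant
    condition [n ^+ 2 <= a * (n * b)] simplifies by [n]. *)
Lemma discriminant_le (R : realFieldType) (a n b : R) : 0 <= a -> 0 <= n -> 0 <= b ->
  (forall t : R, 0 <= a + 2 * t * n + t ^+ 2 * n * b) -> n <= a * b.
Proof.
move=> a0 n0 b0 quad.
have [nz|nnz] := eqVneq n 0; first by rewrite nz mulr_ge0.
have [bz|bnz] := eqVneq b 0.
  (* the quadratic is affine with a nonzero slope: evaluate it where it is -1 *)
  have := quad (- (a + 1) / (2 * n)).
  rewrite bz mulr0 addr0.
  have -> : 2 * (- (a + 1) / (2 * n)) * n = - (a + 1) by field.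
  by lra.
have bgt : 0 < b by rewrite lt_def bnz.
(* the minimum of the quadratic *)
have := quad (- b^-1).
have -> : a + 2 * - b^-1 * n + (- b^-1) ^+ 2 * n * b = (a * b - n) / b by field.
by rewrite pmulr_lge0 ?invr_gt0// subr_ge0.
Qed.

Section SemiInnerProduct.
Variables (R : realType) (V : lmodType R[i]).
Implicit Types (x y z : V).

(** Definiteness is left out so that the same results serve both the inner
    product of the Hilbert space and the form [<A x, y>] of a positive [A]. *)
Record semi_inner (s : V -> V -> R[i]) : Prop := SemiInner {
  si_linear : forall a x y z, s (a *: x + y) z = a * s x z + s y z;
  si_conj : forall x y, s y x = (s x y)^*;
  si_ge0 : forall x, 0 <= s x x }.

Variable s : V -> V -> R[i].
Hypothesis hs : semi_inner s.

Definition seminorm x : R := Num.sqrt (complex.Re (s x x)).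
Local Notation q := seminorm.

Lemma siDl x y z : s (x + y) z = s x z + s y z.
Proof. by rewrite -{1}(scale1r x) (si_linear hs) mul1r. Qed.

Lemma si0l z : s 0 z = 0.
Proof. by apply: (addrI (s 0 z)); rewrite addr0 -siDl addr0. Qed.

Lemma siZl a x z : s (a *: x) z = a * s x z.
Proof. by rewrite -(addr0 (a *: x)) (si_linear hs) si0l addr0. Qed.

Lemma siNl x z : s (- x) z = - s x z.
Proof. by rewrite -scaleN1r siZl mulN1r. Qed.

Lemma siBl x y z : s (x - y) z = s x z - s y z.
Proof. by rewrite siDl siNl. Qed.

Lemma siDr x y z : s z (x + y) = s z x + s z y.
Proof. by rewrite !(si_conj hs _ z) siDl rmorphD. Qed.

Lemma siZr a x z : s z (a *: x) = a^* * s z x.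
Proof. by rewrite !(si_conj hs _ z) siZl rmorphM. Qed.

Lemma siNr x z : s z (- x) = - s z x.
Proof. by rewrite !(si_conj hs _ z) siNl rmorphN. Qed.

Lemma siBr x y z : s z (x - y) = s z x - s z y.
Proof. by rewrite siDr siNr. Qed.

Lemma si0r z : s z 0 = 0.
Proof. by rewrite (si_conj hs) si0l rmorph0. Qed.

Lemma si_diag x : s x x = (q x ^+ 2)%:C.
Proof.
have := si_ge0 hs x; rewrite /q; case: (s x x) => a b.
by rewrite lecE /= => /andP[/eqP -> a0]; rewrite sqr_sqrtr.
Qed.

Lemma seminorm_ge0 x : 0 <= q x. Proof. exact: sqrtr_ge0. Qed.

Lemma seminormZ a x : q (a *: x) = cabs a * q x.
Proof.
apply/eqP; rewrite -(@eqrXn2 _ 2) ?mulr_ge0 ?cabs_ge0 ?seminorm_ge0//; apply/eqP.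
apply: complexI; rewrite -si_diag siZl siZr mulrA cabs_sqr si_diag.
by rewrite -rmorphM exprMn.
Qed.

Lemma seminormN x : q (- x) = q x.
Proof. by rewrite /q siNl siNr opprK. Qed.

Lemma seminorm0 : q 0 = 0.
Proof. by rewrite /q si0l sqrtr0. Qed.

Lemma seminorm_sqrD x y : q (x + y) ^+ 2 = q x ^+ 2 + q y ^+ 2 + 2 * complex.Re (s x y).
Proof.
rewrite -[LHS]ReC -si_diag siDl !siDr !si_diag !ReD !ReC.
by rewrite (si_conj hs x y) ReJ; ring.
Qed.

Lemma seminorm_sqrB x y : q (x - y) ^+ 2 = q x ^+ 2 + q y ^+ 2 - 2 * complex.Re (s x y).
Proof. by rewrite seminorm_sqrD seminormN siNr ReN mulrN. Qed.

Lemma parallelogram x y :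
  q (x + y) ^+ 2 + q (x - y) ^+ 2 = 2 * (q x ^+ 2 + q y ^+ 2).
Proof. by rewrite seminorm_sqrD seminorm_sqrB; ring. Qed.

Lemma cauchy_schwarz x y : cabs (s x y) <= q x * q y.
Proof.
rewrite -(@ler_pXn2r _ 2) ?nnegrE ?mulr_ge0 ?cabs_ge0 ?seminorm_ge0// exprMn.
set n := cabs _ ^+ 2; set a := q x ^+ 2; set b := q y ^+ 2.
have quad (t : R) : 0 <= a + 2 * t * n + t ^+ 2 * n * b.
  suff -> : a + 2 * t * n + t ^+ 2 * n * b = q (x + (t%:C * s x y) *: y) ^+ 2.
    exact: sqr_ge0.
  rewrite seminorm_sqrD seminormZ cabsM cabsC siZr conjMC -(mulrA t%:C) [_^* * _]mulrC.
  rewrite cabs_sqr -/n ReMC ReC.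
  by rewrite !exprMn real_normK ?num_real// -/a -/b -/n; ring.
by apply: discriminant_le quad; exact: sqr_ge0.
Qed.

Lemma seminorm_triangle x y : q (x + y) <= q x + q y.
Proof.
rewrite -(@ler_pXn2r _ 2) ?nnegrE ?addr_ge0 ?seminorm_ge0//.
rewrite seminorm_sqrD sqrrD.
have := Re_le_cabs (s x y); have := cauchy_schwarz x y.
have := ler_norm (complex.Re (s x y)).
by lra.
Qed.

End SemiInnerProduct.

(** * Linear maps and powers *)

(** The operators of the theorem are bare functions with a linearity hypothesis,
    so the usual rewriting rules are restated for such functions. *)

Section LinearMaps.
Variables (K : nzRingType) (U V : lmodType K) (f : U -> V).
Hypothesis lf : linear f.

Lemma linear_mapD x y : f (x + y) = f x + f y.
Proof. by rewrite -{1}(scale1r x) lf scale1r. Qed.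

Lemma linear_map0 : f 0 = 0.
Proof. by apply: (addrI (f 0)); rewrite addr0 -linear_mapD addr0. Qed.

Lemma linear_mapZ a x : f (a *: x) = a *: f x.
Proof. by rewrite -{1}(addr0 (a *: x)) lf linear_map0 addr0. Qed.

Lemma linear_mapB x y : f (x - y) = f x - f y.
Proof. by rewrite linear_mapD -scaleN1r linear_mapZ scaleN1r. Qed.

Lemma linear_scale_map (a : K) : (forall b, GRing.comm a b) -> linear (a *: f).
Proof.
move=> ca b x y; rewrite -![(_ *: f) _]/(_ *: f _) lf scalerDr !scalerA.
by rewrite ca.
Qed.

End LinearMaps.

Lemma bernoulli (R : realDomainType) (d : R) n : 0 <= d -> 1 + n%:R * d <= (1 + d) ^+ n.
Proof.
move=> d0; elim: n => [|n IH]; first by rewrite mul0r addr0 expr0.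
rewrite exprS; apply: (@le_trans _ _ ((1 + d) * (1 + n%:R * d))).
  have : 0 <= n%:R * d ^+ 2 by rewrite mulr_ge0// sqr_ge0.
  by rewrite -natr1; lra.
by rewrite ler_wpM2l// addr_ge0.
Qed.

(** If [t > 1], Bernoulli's inequality makes the powers of [t] unbounded.  Only
    exponents that are powers of two occur because they come from repeatedly
    squaring. *)
Lemma le1_of_bounded_powers (R : archiRealFieldType) (t C : R) : 0 <= t ->
  (forall n, t ^+ (2 ^ n)%N <= C) -> t <= 1.
Proof.
move=> t0 tC; rewrite leNgt; apply/negP => t1.
have d0 : 0 < t - 1 by rewrite subr_gt0.
pose N := Num.truncn (C / (t - 1)).
have CN : C < N.+1%:R * (t - 1) by rewrite -ltr_pdivrMr// Num.Theory.truncnS_gt.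
have := bernoulli (2 ^ N.+1) (ltW d0).
rewrite (_ : 1 + (t - 1) = t) => [le1|]; last by rewrite addrC subrK.
have : N.+1%:R * (t - 1) <= (2 ^ N.+1)%:R * (t - 1).
  by rewrite ler_wpM2r ?(ltW d0)// ler_nat ltnW// ltn_expl.
by have := tC N.+1; move: le1 CN; lra.
Qed.

(** * Operator bounds in a seminorm *)

Section SeminormBounds.
Variables (R : realType) (V : lmodType R[i]).
Variable s : V -> V -> R[i].
Hypothesis hs : semi_inner s.
Local Notation q := (seminorm s).
Implicit Types (x y z : V) (T X B S : V -> V).

Definition adjoint_pair T X := forall x y, s (X x) y = s x (T y).

Lemma adjoint_pair_sym T X : adjoint_pair T X -> adjoint_pair X T.
Proof. by move=> TX x y; rewrite (si_conj hs) -TX -(si_conj hs). Qed.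

(** If a symmetric operator is bounded for a size function [h] that dominates the
    seminorm, its quadratic form is bounded in the seminorm by the same constant.  With [u m] the normalised modulus of
    [<P^m x, x>], symmetry and Cauchy-Schwarz give [u m ^ 2 <= u (2 m)], so
    [u 1 ^ (2 ^ n) <= u (2 ^ n)]; the latter grows at most like [K ^ (2 ^ n)],
    which forces [u 1 <= K]. *)
Lemma krein_lax P (h : V -> R) (c K : R) : adjoint_pair P P -> 0 < K ->
  (forall x, h (P x) <= K * h x) -> 0 <= c -> (forall x, q x <= c * h x) ->
  forall x, cabs (s (P x) x) <= K * q x ^+ 2.
Proof.
move=> PP K0 hP c0 qh x.
have [qx0|qx0] := eqVneq (q x) 0.
  by have := cauchy_schwarz hs (P x) x; rewrite qx0 expr0n !mulr0.
have qx : 0 < q x by rewrite lt_def qx0 seminorm_ge0.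
have q2 : 0 < q x ^+ 2 by rewrite exprn_gt0.
have PPn m y z : s (iter m P y) z = s y (iter m P z).
  by elim: m y z => [|m IH] y z //; rewrite iterS PP IH -iterSr.
have qP m : q (iter m P x) <= c * (K ^+ m * h x).
  apply: (le_trans (qh _)); rewrite ler_wpM2l//.
  elim: m => [|m IH]; first by rewrite mul1r.
  by rewrite iterS exprS -mulrA (le_trans (hP _))// ler_pM2l.
pose u m := cabs (s (iter m P x) x) / q x ^+ 2.
have u0 m : 0 <= u m by rewrite divr_ge0 ?cabs_ge0// ltW.
have usq m : u m ^+ 2 <= u (m * 2)%N.
  suff main : cabs (s (iter m P x) x) ^+ 2 <= cabs (s (iter (m * 2) P x) x) * q x ^+ 2.
    rewrite /u expr_div_n ler_pdivrMr ?exprn_gt0//; apply: (le_trans main).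
    by rewrite le_eqVlt; apply/orP; left; apply/eqP; field.
  rewrite muln2 -addnn iterD (PPn m (iter m P x)) (si_diag hs).
  rewrite cabsC ger0_norm ?sqr_ge0//.
  rewrite -exprMn ler_pXn2r ?nnegrE ?mulr_ge0 ?seminorm_ge0 ?cabs_ge0//.
  exact: cauchy_schwarz.
have upow n : u 1%N ^+ (2 ^ n)%N <= u (2 ^ n)%N.
  elim: n => [|n IH] //; rewrite expnSr exprM (le_trans _ (usq _))//.
  by rewrite ler_pXn2r ?nnegrE ?exprn_ge0.
suff : u 1%N / K <= 1 by rewrite ler_pdivrMr// mul1r /u ler_pdivrMr.
apply: (@le1_of_bounded_powers _ _ (c * h x / q x)) => [|n].
  by rewrite divr_ge0// ltW.
rewrite expr_div_n ler_pdivrMr ?exprn_gt0//; apply: (le_trans (upow n)).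
rewrite /u ler_pdivrMr//; apply: (le_trans (cauchy_schwarz hs _ _)).
have -> : c * h x / q x * K ^+ (2 ^ n) * q x ^+ 2 = c * (K ^+ (2 ^ n) * h x) * q x.
  by field.
by rewrite ler_pM2r.
Qed.

(** A symmetric operator is controlled by its quadratic form: polarization and the
    parallelogram law bound [Re <B x, y>] by [w (||x||^2 + ||y||^2) / 2], and this is
    applied to the multiple [y] of [B x] that has the same seminorm as [x]. *)
Lemma hermitian_bound B (w : R) : linear B -> adjoint_pair B B ->
  (forall x, `|complex.Re (s (B x) x)| <= w * q x ^+ 2) ->
  forall x, q (B x) <= w * q x.
Proof.
move=> lB BB Bw x.
have [qx0|qx0] := eqVneq (q x) 0.
  (* no such multiple exists here, but ||B x||^2 = <x, B (B x)> vanishes *)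
  have := cauchy_schwarz hs x (B (B x)).
  rewrite -BB (si_diag hs) cabsC ger0_norm ?sqr_ge0// qx0 mul0r => le0.
  have : q (B x) ^+ 2 == 0 by rewrite eq_le le0 sqr_ge0.
  by rewrite sqrf_eq0 => /eqP ->; rewrite mulr0.
have qx : 0 < q x by rewrite lt_def qx0 seminorm_ge0.
have [qB0|qB0] := eqVneq (q (B x)) 0.
  rewrite qB0; have := le_trans (normr_ge0 _) (Bw x).
  by rewrite pmulr_lge0 ?exprn_gt0// => w0; rewrite mulr_ge0// ltW.
have qB : 0 < q (B x) by rewrite lt_def qB0 seminorm_ge0.
pose t := q x / q (B x).
have t0 : 0 <= t by rewrite divr_ge0 ?seminorm_ge0.
pose y := t%:C *: B x.
have qy : q y = q x by rewrite (seminormZ hs) cabsC ger0_norm// divfK.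
have sy : complex.Re (s (B x) y) = q x * q (B x).
  rewrite (si_conj hs) ReJ (siZl hs) (si_diag hs) ReMC ReC /t.
  by field.
have polar : 4 * complex.Re (s (B x) y) =
    complex.Re (s (B (x + y)) (x + y)) - complex.Re (s (B (x - y)) (x - y)).
  rewrite (linear_mapD lB) (linear_mapB lB) !(siDl hs) !(siDr hs) !(siNl hs) !(siNr hs).
  rewrite (BB y x) (si_conj hs (B x) y) !(ReD, ReN) ReJ; lra.
have := Bw (x + y); have := Bw (x - y).
rewrite !ler_norml => /andP[lo _] /andP[_ hi].
have := parallelogram hs x y; rewrite qy => pl.
have : q x * q (B x) <= w * q x ^+ 2.
  have : w * (q (x + y) ^+ 2 + q (x - y) ^+ 2) = 4 * (w * q x ^+ 2) by rewrite pl; ring.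
  by move: lo hi polar; rewrite sy; lra.
by rewrite (_ : w * q x ^+ 2 = q x * (w * q x)) ?ler_pM2l//; ring.
Qed.

(** Here [X] is any adjoint of [T] for the semi-inner product, of which there can
    be several when the latter is degenerate. *)
Definition re_part T X : V -> V := 2^-1 *: (T + X).
Definition im_part T X : V -> V := (2 * 'i%C)^-1 *: (T - X).

Lemma linear_re_part T X : linear T -> linear X -> linear (re_part T X).
Proof.
move=> lT lX; apply: linear_scale_map; last by move=> b; exact: mulrC.
by move=> a x y; rewrite -![(T + X) _]/(T _ + X _) lT lX addrACA -scalerDr.
Qed.

Lemma linear_im_part T X : linear T -> linear X -> linear (im_part T X).
Proof.
move=> lT lX; apply: linear_scale_map; last by move=> b; exact: mulrC.
by move=> a x y; rewrite -![(T - X) _]/(T _ - X _) lT lX opprD addrACA -scalerBr.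
Qed.

Lemma re_part_bound T X (w : R) : linear T -> linear X -> adjoint_pair T X ->
  (forall x, cabs (s (T x) x) <= w * q x ^+ 2) ->
  forall x, q (re_part T X x) <= w * q x.
Proof.
move=> lT lX TX Tw.
have XT := adjoint_pair_sym TX.
have reE x : re_part T X x = 2^-1 *: (T x + X x) by [].
apply: hermitian_bound.
- exact: linear_re_part.
- move=> x y; rewrite !reE (siZl hs) (siZr hs) (siDl hs) (siDr hs) TX XT addrC.
  by rewrite fmorphV rmorph_nat.
- move=> x; rewrite reE (siZl hs) (siDl hs) half_realC ReMC ReD TX.
  rewrite (si_conj hs (T x) x) ReJ.
  rewrite (_ : 2^-1 * _ = complex.Re (s (T x) x)); last by field.
  exact: le_trans (Re_le_cabs _) (Tw x).
Qed.

(** The imaginary part of [T] is the real part of [- i T], and multiplication by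
    [- i] does not change the modulus of [<T x, x>]. *)
Lemma im_part_bound T X (w : R) : linear T -> linear X -> adjoint_pair T X ->
  (forall x, cabs (s (T x) x) <= w * q x ^+ 2) ->
  forall x, q (im_part T X x) <= w * q x.
Proof.
move=> lT lX TX Tw x.
have Ji : (- ('i%C : R[i]))^* = 'i%C by apply/eqP; rewrite eq_complex /= oppr0 opprK !eqxx.
have -> : im_part T X x = re_part ((- 'i%C) *: T) ('i%C *: X) x.
  rewrite -[LHS]/(_ *: (T x - X x)) -[RHS]/(_ *: (- 'i%C *: T x + 'i%C *: X x)).
  rewrite invfM invi -scalerA scaleNr -scalerN opprB scalerBr.
  by congr (_ *: _); rewrite scaleNr addrC.
apply: re_part_bound => [|||y].
- by apply: linear_scale_map => // b; exact: mulrC.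
- by apply: linear_scale_map => // b; exact: mulrC.
- move=> y z; rewrite -[(_ *: X) y]/(_ *: X y) -[(_ *: T) z]/(_ *: T z).
  by rewrite (siZl hs) (siZr hs) TX Ji.
- by rewrite -[(_ *: T) y]/(_ *: T y) (siZl hs) cabsM cabsN cabsi mul1r.
Qed.

Lemma re_im_parallelogram T X x :
  q (T x) ^+ 2 + q (X x) ^+ 2 = 2 * (q (re_part T X x) ^+ 2 + q (im_part T X x) ^+ 2).
Proof.
have c2 : cabs (2^-1) = 2^-1 :> R by rewrite half_realC cabsC ger0_norm.
rewrite -[re_part T X x]/(_ *: (T x + X x)) -[im_part T X x]/(_ *: (T x - X x)).
rewrite !(seminormZ hs) invfM invi cabsM cabsN cabsi mulr1.
have := parallelogram hs (T x) (X x); rewrite !exprMn c2.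
by lra.
Qed.

(** The pointwise core of the theorem; [e] is the sign. *)
Lemma commutator_bound T X S (e : R[i]) (nS nB nC w : R) x :
  adjoint_pair T X -> cabs e = 1 -> 0 <= nS ->
  (forall y, q (S y) <= nS * q y) ->
  q (re_part T X x) <= nB -> q (im_part T X x) <= nC -> nB <= w -> nC <= w -> q x = 1 ->
  cabs (s (T (S x) + e *: S (T x)) x) <=
    2 * Num.sqrt 2 * nS * Num.sqrt (w ^+ 2 - `|nB ^+ 2 - nC ^+ 2| / 2).
Proof.
move=> TX e1 nS0 Sb Bb Cb Bw Cw qx.
set D := w ^+ 2 - _.
have nB0 : 0 <= nB by apply: le_trans Bb; exact: seminorm_ge0.
have nC0 : 0 <= nC by apply: le_trans Cb; exact: seminorm_ge0.
have B2 : q (re_part T X x) ^+ 2 <= nB ^+ 2 by rewrite ler_pXn2r ?nnegrE ?seminorm_ge0.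
have C2 : q (im_part T X x) ^+ 2 <= nC ^+ 2 by rewrite ler_pXn2r ?nnegrE ?seminorm_ge0.
have Bw2 : nB ^+ 2 <= w ^+ 2 by rewrite ler_pXn2r ?nnegrE// (le_trans nB0).
have Cw2 : nC ^+ 2 <= w ^+ 2 by rewrite ler_pXn2r ?nnegrE// (le_trans nC0).
(* nB ^+ 2 + nC ^+ 2 + |nB ^+ 2 - nC ^+ 2| is twice the larger of the two squares *)
have BCD : nB ^+ 2 + nC ^+ 2 <= 2 * D.
  by rewrite /D; case: (ger0P (nB ^+ 2 - nC ^+ 2)); lra.
have D0 : 0 <= D by have := sqr_ge0 nB; have := sqr_ge0 nC; lra.
have le1 : cabs (s (T (S x) + e *: S (T x)) x) <= nS * (q (T x) + q (X x)).
  rewrite (siDl hs) (siZl hs); apply: (le_trans (cabsD _ _)).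
  rewrite cabsM e1 mul1r mulrDr addrC lerD//.
    by have := cauchy_schwarz hs (S (T x)) x; rewrite qx mulr1 => /le_trans; apply.
  rewrite (adjoint_pair_sym TX); apply: (le_trans (cauchy_schwarz hs _ _)).
  by rewrite ler_wpM2r ?seminorm_ge0//; have := Sb x; rewrite qx mulr1.
apply: (le_trans le1); rewrite [2 * _ * nS]mulrC -mulrA ler_wpM2l//.
rewrite -(@ler_pXn2r _ 2) ?nnegrE ?mulr_ge0 ?addr_ge0 ?seminorm_ge0 ?sqrtr_ge0//.
rewrite !exprMn !sqr_sqrtr//.
have := re_im_parallelogram T X x.
(* (a + b)^2 <= 2 (a^2 + b^2) *)
have := sqr_ge0 (q (T x) - q (X x)).
by rewrite sqrrB sqrrD; lra.
Qed.

End SeminormBounds.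

(** * Hilbert space geometry *)

Section HilbertSpace.
Local Open Scope classical_set_scope.
Variables (R : realType) (H : hilbertType R).
Implicit Types (x y z : H).

Lemma inn_semi_inner : semi_inner (@inn R H).
Proof.
split.
- by move=> a x y z; rewrite /inn linearPl.
- by move=> x y; rewrite /inn hermC expr0 mul1r.
- by move=> x; rewrite /inn -inner_normE exprn_ge0.
Qed.

Local Notation hs := inn_semi_inner.
(* [harmonic n] has to stay an atom for the linear arithmetic below. *)
Local Arguments harmonic : simpl never.
Local Notation hn := (seminorm (@inn R H)).

Lemma normE_seminorm x : `|x| = (hn x)%:C.
Proof.
apply/eqP; rewrite -(@eqrXn2 _ 2)//; last by rewrite ler0c seminorm_ge0.
by rewrite inner_normE -/(inn x x) (si_diag hs) rmorphXn.
Qed.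

Lemma seminorm_eq0 x : hn x = 0 -> x = 0.
Proof. by move=> e; apply/eqP; rewrite -normr_eq0 normE_seminorm e. Qed.

Lemma exists_harmonic_lt (e : R) : 0 < e ->
  exists N, forall n, (N <= n)%N -> harmonic n < e.
Proof.
move=> e0; exists (Num.truncn e^-1) => n Nn; rewrite /harmonic /=.
rewrite -ltf_pV2 ?(posrE,invr_gt0)// invrK.
apply: (lt_le_trans (Num.Theory.truncnS_gt _)); by rewrite ler_nat.
Qed.

Lemma harmonic_half n : harmonic n / 2 <= harmonic n.+1 :> R.
Proof.
rewrite /harmonic /= -invfM lef_pV2 ?posrE ?mulr_gt0//.
by rewrite -natrM ler_nat muln2 -addnn addSnnS leq_addl.
Qed.

(** Completeness restated with real radii.  Comparing only with the [N]-th term is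
    enough for the Cauchy property and is what the applications provide. *)
Lemma hilbert_complete (u : nat -> H) :
  (forall e : R, 0 < e ->
     exists N, forall n, (N <= n)%N -> hn (u n - u N) < e) ->
  exists l, forall e : R, 0 < e ->
     exists N, forall n, (N <= n)%N -> hn (u n - l) < e.
Proof.
move=> cu.
have cvu : cvg (u @ \oo).
  apply: cauchy_cvg; apply: cauchy_exP => e e0.
  have eE : e = (complex.Re e)%:C by rewrite RRe_real// gtr0_real.
  move: e0; rewrite eE ltcR => e0.
  have [N HN] := cu _ e0.
  exists (u N), N => // n /= Nn.
  rewrite -ball_normE /ball_ /= distrC normE_seminorm ltcR.
  exact: HN.
exists (lim (u @ \oo)) => e e0.
have e0C : 0 < e%:C by rewrite ltcR.
have /cvgrPdist_lt /(_ _ e0C)[N _ HN] := cvu.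
by exists N => n Nn; rewrite -ltcR -normE_seminorm distrC; exact: HN.
Qed.

Section Projection.
Variable M : set H.
Hypothesis M0 : M 0.
Hypothesis M_lin : forall a x y, M x -> M y -> M (a *: x + y).
(* closedness of [M], phrased with real radii *)
Hypothesis M_closed :
  forall x, (forall e : R, 0 < e -> exists m, M m /\ hn (x - m) < e) -> M x.

(** Moving [m] by a multiple [t <x - m, z>] of [z] cannot decrease the distance to
    [x]; the discriminant of the resulting quadratic in [t] is then [0]. *)
Lemma orthogonal_of_nearest x m : M m ->
  (forall m', M m' -> hn (x - m) ^+ 2 <= hn (x - m') ^+ 2) ->
  forall z, M z -> inn (x - m) z = 0.
Proof.
move=> Mm mmin z Mz; set c := inn _ z.
suff : cabs c ^+ 2 <= 0 * hn z ^+ 2.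
  rewrite mul0r => c0; apply/eqP; rewrite -normr_eq0 cabsE.
  by rewrite (_ : cabs c = 0)//; apply/eqP; rewrite -sqrf_eq0 eq_le c0 sqr_ge0.
apply: discriminant_le => //; try exact: sqr_ge0.
move=> t.
have /mmin : M ((- (t%:C * c)) *: z + m) by exact: M_lin.
rewrite scaleNr opprD opprK addrCA -subr_ge0 addrC.
rewrite [in leRHS](seminorm_sqrD hs) (seminormZ hs) cabsM cabsC (siZr hs) -/c.
rewrite conjMC -(mulrA t%:C) [_^* * _]mulrC cabs_sqr ReMC ReC.
by rewrite !exprMn real_normK ?num_real//; lra.
Qed.

(** A minimizing sequence [u] is Cauchy by the parallelogram law, since the midpoint
    of two of its terms is still in [M]; its limit is nearest to [x]. *)
Lemma orthogonal_projection x : exists m, M m /\ forall z, M z -> inn (x - m) z = 0.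
Proof.
pose D := [set hn (x - m) ^+ 2 | m in M].
have infD : has_inf D.
  split; first by exists (hn (x - 0) ^+ 2), 0.
  by exists 0 => _ [m _ <-]; exact: sqr_ge0.
have dlb m : M m -> inf D <= hn (x - m) ^+ 2.
  by move=> Mm; apply: ge_inf; [exact: infD.2|exists m].
have d0 : 0 <= inf D.
  by apply: lb_le_inf; [exact: infD.1|move=> _ [m _ <-]; exact: sqr_ge0].
have /choice[u Hu] (n : nat) : exists m, M m /\ hn (x - m) ^+ 2 < inf D + harmonic n.
  have [_ [m Mm <-] lt_m] := @inf_adherent R D (harmonic n) (harmonic_gt0 _) infD.
  by exists m.
have [|l Hl] := @hilbert_complete u.
  move=> e e0.
  have [|N HN] := @exists_harmonic_lt (e ^+ 2 / 4); first by rewrite divr_gt0// exprn_gt0.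
  exists N => n Nn.
  rewrite -(@ltr_pXn2r _ 2) ?nnegrE ?seminorm_ge0//; last exact: ltW.
  (* the midpoint; the trailing 0 puts it in the shape of [M_lin] *)
  have mid : M (2^-1 *: u n + (2^-1 *: u N + 0)).
    by apply: (M_lin _ (Hu n).1); exact: (M_lin _ (Hu N).1).
  have := parallelogram hs (x - u N) (x - u n).
  have -> : (x - u N) - (x - u n) = u n - u N.
    by rewrite opprB addrC addrA subrK.
  have -> : (x - u N) + (x - u n) = 2 *: (x - (2^-1 *: u n + (2^-1 *: u N + 0))).
    rewrite addr0 scalerBr scalerDr !scalerA divff// !scale1r.
    by rewrite scaler_nat mulr2n opprD [- u n - _]addrC addrACA.
  rewrite (seminormZ hs) (_ : cabs 2 = 2); last by rewrite /cabs normr_nat.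
  have := dlb _ mid.
  have := (Hu n).2; have := (Hu N).2; have := HN _ Nn; have := HN _ (leqnn N).
  rewrite exprMn; lra.
have Ml : M l.
  apply: M_closed => e e0; have [N HN] := Hl _ e0.
  by exists (u N); split; [exact: (Hu N).1|rewrite -opprB (seminormN hs); exact: HN].
exists l; split => //; apply: orthogonal_of_nearest => // m' Mm'.
apply: (le_trans _ (dlb _ Mm')).
rewrite -[leRHS]sqr_sqrtr// ler_pXn2r ?nnegrE ?sqrtr_ge0 ?seminorm_ge0//.
apply/ler_addgt0Pr => e e0.
have e20 : 0 < e / 2 by rewrite divr_gt0.
have [N1 HN1] := @exists_harmonic_lt ((e / 2) ^+ 2) (exprn_gt0 2 e20).
have [N2 HN2] := Hl _ e20.
have {HN1} lt1 := HN1 _ (leq_maxl N1 N2).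
have {HN2} lt2 := HN2 _ (leq_maxr N1 N2).
set n := maxn N1 N2 in lt1 lt2.
have -> : x - l = (x - u n) + (u n - l) by rewrite addrA subrK.
apply: (le_trans (seminorm_triangle hs _ _)).
suff : hn (x - u n) <= Num.sqrt (inf D) + e / 2 by move: lt2; lra.
rewrite -(@ler_pXn2r _ 2) ?nnegrE ?addr_ge0 ?sqrtr_ge0 ?seminorm_ge0// ?(ltW e20)//.
rewrite sqrrD (sqr_sqrtr d0).
have : 0 <= Num.sqrt (inf D) * (e / 2) by rewrite mulr_ge0 ?sqrtr_ge0// ltW.
by have := (Hu n).2; lra.
Qed.

End Projection.

(** If [f] is not zero, let [w] be the component of some [v], [f v != 0], orthogonal to the
    kernel.  Subtracting [(f x / f w) w] from [x] lands in the kernel, so [f] is a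
    multiple of [<., w>]. *)
Lemma riesz_representation (f : H -> R[i]) (C : R) :
  (forall a x y, f (a *: x + y) = a * f x + f y) ->
  (forall x, cabs (f x) <= C * hn x) ->
  exists z, forall x, f x = inn x z.
Proof.
move=> fl fC.
have f0 : f 0 = 0.
  by apply: (addrI (f 0)); rewrite addr0 -{1}[f 0]mul1r -fl scaler0 addr0.
have fB x y : f (x - y) = f x - f y.
  by rewrite addrC -scaleN1r fl mulN1r addrC.
have fZ a x : f (a *: x) = a * f x by rewrite -[a *: x]addr0 fl f0 addr0.
have [[v fu]|nofu] := pselect (exists u, f u <> 0); last first.
  exists 0 => x; rewrite (si0r hs); apply: contrapT => fx.
  by apply: nofu; exists x.
have [|||m [fm orth]] := @orthogonal_projection [set x | f x = 0] _ _ _ v => //=.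
- by move=> a x y fx fy; rewrite fl fx fy mulr0 addr0.
- move=> x Hx; apply/eqP; rewrite -normr_eq0 cabsE.
  suff le0 : cabs (f x) <= 0.
    by rewrite (_ : cabs (f x) = 0)//; apply: le_anti; rewrite le0 cabs_ge0.
  apply/ler_addgt0Pr => e e0; rewrite add0r.
  have C0 : 0 < `|C| + 1 by rewrite ltr_wpDl.
  have [|m [fm lt_e]] := Hx (e / (`|C| + 1)); first by rewrite divr_gt0.
  have -> : f x = f (x - m) by rewrite fB fm subr0.
  apply: (le_trans (fC _)).
  apply: (@le_trans _ _ ((`|C| + 1) * hn (x - m))).
    by apply: ler_wpM2r; [exact: seminorm_ge0|have := ler_norm C; lra].
  by rewrite mulrC -ler_pdivlMr// ltW.
have fvm : f (v - m) = f v by rewrite fB fm subr0.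
move: orth; set w := v - m in fvm * => orth.
have ww : inn w w != 0.
  rewrite (si_diag hs); apply/negP => /eqP e; apply: fu.
  rewrite -fvm (_ : w = 0)//; apply: seminorm_eq0; apply/eqP.
  by rewrite -sqrf_eq0; apply/eqP; apply: complexI; rewrite e.
have fw : f w != 0 by rewrite fvm; apply/eqP.
exists ((f w / inn w w)^* *: w) => x.
have /orth ow : f (x - (f x / f w) *: w) = 0 by rewrite fB fZ divfK ?subrr.
have : inn (x - (f x / f w) *: w) w = 0 by rewrite (si_conj hs) ow rmorph0.
rewrite (siBl hs) (siZl hs) => /eqP; rewrite subr_eq0 => /eqP e.
by rewrite (siZr hs) conjCK e mulrACA mulVf// mulr1 mulrC divfK.
Qed.

(** The uniform boundedness principle for the functionals [<., w>], [w] in [W].  If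
    [W] were unbounded, any ball would contain a smaller ball on which some
    [|<., w>|] exceeds a prescribed [n]: for [w] long enough this already happens at
    the centre of the ball or at the centre moved along [w] by half the radius.
    The centres of a nested sequence of such balls converge to a point at which
    [W] is not bounded. *)
Lemma weakly_bounded_bounded (W : set H) :
  (forall x, exists K : R, forall w, W w -> cabs (inn x w) <= K) ->
  exists K : R, forall w, W w -> hn w <= K.
Proof.
move=> wb; apply: contrapT => unb.
have big (K : R) : exists w, W w /\ K < hn w.
  apply: contrapT => nw; apply: unb; exists K => w Ww.
  by rewrite leNgt; apply/negP => lt; apply: nw; exists w.
(* a state (n, (a, r)) is the n-th ball, with centre a and radius r *)
pose P (s t : nat * (H * R)) := 0 < s.2.2 ->
  [/\ t.1 = s.1.+1, 0 < t.2.2, t.2.2 <= s.2.2 / 2, hn (t.2.1 - s.2.1) <= s.2.2 / 2 &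
   exists w, W w /\ forall y, hn (y - t.2.1) <= t.2.2 -> s.1%:R <= cabs (inn y w)].
have step s : exists t, P s t.
  case: s => n [a r]; have [r0|] := ltrP 0 r; last by exists (0%N, (a, r)); rewrite /P /=; lra.
  have n10 : 0 < n%:R + 1 :> R by rewrite ltr_wpDl.
  (* the two candidate values differ by r / 2 * hn w > 2 * (n + 1) *)
  have [w [Ww lw]] := big (4 * (n%:R + 1) / r).
  have w0 : 0 < hn w by apply: lt_trans lw; rewrite divr_gt0// mulr_gt0.
  have [b [ab blarge]] : exists b, hn (b - a) <= r / 2 /\ n%:R + 1 <= cabs (inn b w).
    have [aw|aw] := lerP (n%:R + 1) (cabs (inn a w)).
      by exists a; rewrite subrr (seminorm0 hs); split => //; lra.
    exists (a + (r / 2 / hn w)%:C *: w); split.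
      rewrite addrAC subrr add0r (seminormZ hs) cabsC ger0_norm ?divfK ?gt_eqF//.
      by rewrite !divr_ge0 ?ltW.
    have : cabs (inn ((r / 2 / hn w)%:C *: w) w) = r / 2 * hn w.
      rewrite (siZl hs) (si_diag hs) -rmorphM cabsC ger0_norm.
        by field; rewrite gt_eqF.
      by rewrite mulr_ge0 ?sqr_ge0// !divr_ge0 ?ltW.
    have := cabsD (inn (a + (r / 2 / hn w)%:C *: w) w) (- inn a w).
    rewrite -(siBl hs) addrAC subrr add0r cabsN => le1 e1.
    move: lw; rewrite ltr_pdivrMr// => lw.
    by move: le1 e1 lw aw; lra.
  (* in a radius (hn w)^-1 the value changes by at most 1 *)
  exists (n.+1, (b, Num.min (r / 2) (hn w)^-1)) => _ /=; split => //.
  - by rewrite lt_min invr_gt0 w0 divr_gt0.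
  - by rewrite ge_min lexx.
  exists w; split => // y; rewrite le_min => /andP[_ yb].
  have := cabsD (inn y w) (inn (b - y) w).
  rewrite -(siDl hs) subrKC => le1.
  have le2 := cauchy_schwarz hs (b - y) w.
  have : hn (b - y) * hn w <= 1.
    by rewrite -(opprB y) (seminormN hs) -ler_pdivlMr// div1r.
  by move: blarge le1 le2; lra.
have [g Pg] := choice step.
pose S := fix S n := if n is m.+1 then g (S m) else (0%N, (0 : H, 1 : R)).
pose x n := (S n).2.1; pose r n := (S n).2.2.
have r0 n : 0 < r n.
  by elim: n => [|n IH]; rewrite /r //=; case: (Pg _ IH).
have Sn n : (S n).1 = n.
  by elim: n => [|n IH] //=; case: (Pg _ (r0 n)) => ->; rewrite IH.
have rhalf n : r n.+1 <= r n / 2 by case: (Pg _ (r0 n)).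
have xstep n : hn (x n.+1 - x n) <= r n / 2 by case: (Pg _ (r0 n)).
have Sw n : exists w, W w /\
    forall y, hn (y - x n.+1) <= r n.+1 -> n%:R <= cabs (inn y w).
  by case: (Pg _ (r0 n)) => _ _ _ _; rewrite Sn.
have rinv n : r n <= harmonic n.
  elim: n => [|n IH]; first by rewrite /harmonic /= invr1.
  have := rhalf n; have := harmonic_half n; lra.
have nested n k : hn (x (k + n)%N - x n) <= r n - r (k + n)%N.
  elim: k => [|k IH]; first by rewrite !subrr (seminorm0 hs).
  rewrite addSn; set m := (k + n)%N in IH *.
  have -> : x m.+1 - x n = (x m.+1 - x m) + (x m - x n) by rewrite addrA subrK.
  have := seminorm_triangle hs (x m.+1 - x m) (x m - x n).
  by have := rhalf m; have := xstep m; move: IH; lra.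
have [|l Hl] := @hilbert_complete x.
  move=> e e0; have [N HN] := exists_harmonic_lt e0; exists N => n Nn.
  have := nested N (n - N)%N; rewrite subnK// => le1.
  by have := HN _ (leqnn N); have := rinv N; have := r0 n; move: le1; lra.
have lball n : hn (l - x n) <= r n.
  apply/ler_addgt0Pr => e e0; have [N HN] := Hl _ e0.
  have := HN _ (leq_addr n N); have := nested n N; have := r0 (N + n)%N.
  have -> : l - x n = (x (N + n)%N - x n) - (x (N + n)%N - l).
    by rewrite opprB [RHS]addrC addrA subrK.
  have := seminorm_triangle hs (x (N + n)%N - x n) (- (x (N + n)%N - l)).
  by rewrite (seminormN hs); lra.
have [K HK] := wb l.
have [w [Ww le_n]] := Sw (Num.truncn K).+1.
have := le_n _ (lball _); have := HK _ Ww; have := Num.Theory.truncnS_gt K; lra.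
Qed.

End HilbertSpace.

(** * Bounded and positive operators *)

Section Operators.
Local Open Scope classical_set_scope.
Variables (R : realType) (H : hilbertType R).
Implicit Types (x y z : H) (A T S X : H -> H).

Local Notation hs := (@inn_semi_inner R H).
Local Notation hn := (seminorm (@inn R H)).

Lemma bounded_operator_bound T : bounded_operator T ->
  exists K : R, 0 < K /\ forall x, hn (T x) <= K * hn x.
Proof.
move=> [_ [M HM]]; exists (`|M| + 1); split; first by rewrite ltr_wpDl.
move=> x; have := HM x; rewrite !normE_seminorm -rmorphM lecR => /le_trans; apply.
by apply: ler_wpM2r; [exact: seminorm_ge0|have := ler_norm M; lra].
Qed.

Lemma bounded_operator_intro T (K : R) : linear T ->
  (forall x, hn (T x) <= K * hn x) -> bounded_operator T.
Proof.
by move=> lT HK; split=> //; exists K => x; rewrite !normE_seminorm -rmorphM lecR.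
Qed.

Lemma inn_ext x y : (forall z, inn z x = inn z y) -> x = y.
Proof.
move=> e; apply/eqP; rewrite -subr_eq0; apply/eqP/seminorm_eq0/eqP.
rewrite -sqrf_eq0; apply/eqP/complexI.
by rewrite -(si_diag hs) (siBr hs) e subrr.
Qed.

(** [S y] represents the functional [<T ., y>]; its linearity is the uniqueness of the
    representing vector, and [||S y||^2 = <T (S y), y>] bounds it. *)
Lemma adjointP T : bounded_operator T ->
  bounded_operator (adjoint T) /\ forall x y, inn (T x) y = inn x (adjoint T y).
Proof.
move=> bT.
pose P := [set S | bounded_operator S /\ forall x y, inn (T x) y = inn x (S y)].
suff : P (get P) by [].
apply: getPex.
have [K [K0 TK]] := bounded_operator_bound bT.
have /choice[S HS] y : exists z, forall x, inn (T x) y = inn x z.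
  apply: (@riesz_representation _ _ (fun x => inn (T x) y) (K * hn y)).
    by move=> a x x'; rewrite bT.1 (si_linear hs).
  move=> x; apply: (le_trans (cauchy_schwarz hs _ _)).
  by rewrite mulrAC ler_wpM2r ?seminorm_ge0.
exists S; split; last by move=> x y; exact: HS.
apply: (@bounded_operator_intro _ K).
  move=> a x y; apply: inn_ext => z.
  by rewrite -HS !(siDr hs) !(siZr hs) -!HS.
move=> y; have [e|ne] := eqVneq (hn (S y)) 0.
  by rewrite e mulr_ge0 ?seminorm_ge0// ltW.
have gt0 : 0 < hn (S y) by rewrite lt_def ne seminorm_ge0.
rewrite -(ler_pM2l gt0) -expr2.
have -> : hn (S y) ^+ 2 = cabs (inn (T (S y)) y).
  by rewrite HS (si_diag hs) cabsC ger0_norm// sqr_ge0.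
apply: (le_trans (cauchy_schwarz hs _ _)).
by rewrite mulrA [_ * K]mulrC ler_wpM2r ?seminorm_ge0.
Qed.

(** Over the complex numbers a form with real diagonal is hermitian: polarize with
    [x + y] and [x + i y]. *)
Lemma positive_conj A : positive_operator A -> forall x y, innA A y x = (innA A x y)^*.
Proof.
move=> [[lA _] A0] x y; rewrite /innA.
have real z : complex.Im (inn (A z) z) = 0 by exact: ger0_Im (A0 z).
have := real (x + y); have := real (x + 'i%C *: y).
rewrite !(linear_mapD lA) !(linear_mapZ lA).
rewrite !(siDl hs) !(siDr hs) !(siZl hs) !(siZr hs).
have := real x; have := real y.
case: (inn (A x) x) => a b; case: (inn (A y) y) => a' b' /= -> ->.
case: (inn (A x) y) => c d; case: (inn (A y) x) => c' d' /=.
move=> e1 e2; apply/eqP; rewrite eq_complex /=.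
by apply/andP; split; apply/eqP; lra.
Qed.

Lemma positive_semi_inner A : positive_operator A -> semi_inner (innA A).
Proof.
move=> pA; split.
- by move=> a x y z; rewrite /innA pA.1.1 (si_linear hs).
- exact: positive_conj.
- exact: pA.2.
Qed.

Lemma positive_hermitian A : positive_operator A ->
  forall x y, inn (A x) y = inn x (A y).
Proof.
move=> pA x y; have := positive_conj pA y x; rewrite /innA => ->.
by rewrite -(si_conj hs).
Qed.

Lemma closure_seminormP (E : set H) x :
  closure E x <-> forall e : R, 0 < e -> exists m, E m /\ hn (x - m) < e.
Proof.
split=> [clx e e0|Ex].
  have e0C : 0 < e%:C by rewrite ltcR.
  have [m [Em]] := clx _ (nbhsx_ballx x _ e0C).
  by rewrite -ball_normE /ball_ /= normE_seminorm ltcR => lt; exists m.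
move=> B /nbhs_ballP[e /= e0 eB].
have eE : e = (complex.Re e)%:C by rewrite RRe_real// gtr0_real.
move: e0; rewrite eE ltcR => /Ex[m [Em lt]].
exists m; split => //; apply: eB.
by rewrite -ball_normE /ball_ /= normE_seminorm eE ltcR.
Qed.

(** * The reduced solution of A X = T^* A *)

Section Douglas.
Variables (A T : H -> H).
Hypothesis pA : positive_operator A.
Hypothesis TA : BA A T.

Let M := closure (range A).

Let M0 : M 0.
Proof.
apply: subset_closure; exists 0 => //; exact: linear_map0 pA.1.1.
Qed.

Let M_lin a x y : M x -> M y -> M (a *: x + y).
Proof.
move=> /closure_seminormP Mx /closure_seminormP My; apply/closure_seminormP => e e0.
have a0 : 0 < cabs a + 1 by rewrite ltr_wpDl ?cabs_ge0.
have [|_ [[u _ <-] ltu]] := Mx (e / 2 / (cabs a + 1)); first by rewrite !divr_gt0.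
have [|_ [[v _ <-] ltv]] := My (e / 2); first by rewrite divr_gt0.
exists (A (a *: u + v)); split; first by exists (a *: u + v).
rewrite pA.1.1 opprD addrACA -scalerBr.
apply: (le_lt_trans (seminorm_triangle hs _ _)); rewrite (seminormZ hs).
move: ltu; rewrite ltr_pdivlMr// mulrDr mulr1 mulrC => ltu.
by have := seminorm_ge0 (@inn R H) (x - A u); move: ltu ltv; lra.
Qed.

Let M_closed x : (forall e : R, 0 < e -> exists m, M m /\ hn (x - m) < e) -> M x.
Proof.
move=> Hx; apply/closure_seminormP => e e0.
have e2 : 0 < e / 2 by rewrite divr_gt0.
have [m [/closure_seminormP/(_ _ e2)[m' [Em' lt']] lt]] := Hx _ e2.
exists m'; split => //.
have -> : x - m' = (x - m) + (m - m') by rewrite addrA subrK.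
by apply: (le_lt_trans (seminorm_triangle hs _ _)); move: lt lt'; lra.
Qed.

(** The kernel of [A] is orthogonal to its range.  This makes the reduced solution
    unique, hence linear. *)
Lemma closure_range_ker0 y : M y -> A y = 0 -> y = 0.
Proof.
move=> /closure_seminormP My Ay0; apply: seminorm_eq0; apply/eqP.
rewrite -sqrf_eq0 eq_le sqr_ge0 andbT.
apply/ler_addgt0Pr => e e0; rewrite add0r.
have h0 : 0 < hn y + 1 by rewrite ltr_wpDl ?seminorm_ge0.
have [|_ [[z _ <-] lt]] := My (e / (hn y + 1)); first by rewrite divr_gt0.
have yA : inn y (A z) = 0 by rewrite -(positive_hermitian pA) Ay0 (si0l hs).
have -> : hn y ^+ 2 = cabs (inn y (y - A z)).
  by rewrite (siBr hs) yA subr0 (si_diag hs) cabsC ger0_norm// sqr_ge0.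
apply: (le_trans (cauchy_schwarz hs _ _)).
move: lt; rewrite ltr_pdivlMr// mulrDr mulr1 mulrC.
by have := seminorm_ge0 (@inn R H) (y - A z); lra.
Qed.

(** Since [<X x, A y> = <x, A T y>], the set of the [A T y] with [||A y|| <= 1] is
    weakly bounded, by [||X x||] at [x].  It is then bounded by some [K], which gives
    [|<X x, A y>| <= K ||x|| ||A y||]; approximating [X x] by vectors [A y] ends
    the proof. *)
Lemma reduced_solution_bounded X : (forall x, M (X x)) ->
  (forall x, A (X x) = adjoint T (A x)) ->
  exists K : R, forall x, hn (X x) <= K * hn x.
Proof.
move=> XM AX.
have [_ Tadj] := adjointP TA.1.
have dual x y : inn (X x) (A y) = inn x (A (T y)).
  rewrite -!(positive_hermitian pA) AX.
  by rewrite (si_conj hs) -Tadj -(si_conj hs).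
have [|K0 HK0] := @weakly_bounded_bounded R H
    [set A (T y) | y in [set y | hn (A y) <= 1]].
  move=> x; exists (hn (X x)) => _ [y /= Ay <-].
  rewrite -dual; apply: (le_trans (cauchy_schwarz hs _ _)).
  by rewrite ler_piMr ?seminorm_ge0.
pose K := `|K0|.
have HK y : hn (A y) <= 1 -> hn (A (T y)) <= K.
  by move=> Ay; apply: (le_trans _ (ler_norm _)); apply: HK0; exists y.
have bound x y : cabs (inn (X x) (A y)) <= K * hn x * hn (A y).
  have [e|ne] := eqVneq (hn (A y)) 0.
    by rewrite (seminorm_eq0 e) (si0r hs) (seminorm0 hs) mulr0 /cabs normr0.
  have gt0 : 0 < hn (A y) by rewrite lt_def ne seminorm_ge0.
  pose t := (hn (A y))^-1.
  have t0 : 0 <= t by rewrite invr_ge0 ltW.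
  have : hn (A (T (t%:C *: y))) <= K.
    apply: HK; rewrite (linear_mapZ pA.1.1) (seminormZ hs) cabsC ger0_norm//.
    by rewrite mulVf.
  rewrite (linear_mapZ TA.1.1) (linear_mapZ pA.1.1) (seminormZ hs).
  rewrite cabsC ger0_norm// => le1.
  rewrite -ler_pdivrMr// mulrC dual; apply: (@le_trans _ _ (t * (hn x * hn (A (T y))))).
    by rewrite ler_wpM2l// (cauchy_schwarz hs).
  by rewrite mulrCA mulrC ler_wpM2r ?seminorm_ge0.
exists K => x; have [e|ne] := eqVneq (hn (X x)) 0.
  by rewrite e mulr_ge0 ?seminorm_ge0 ?normr_ge0.
have gt0 : 0 < hn (X x) by rewrite lt_def ne seminorm_ge0.
have k0 : 0 <= K * hn x by rewrite mulr_ge0 ?seminorm_ge0 ?normr_ge0.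
rewrite -(ler_pM2l gt0); apply/ler_addgt0Pr => e e0.
have h0 : 0 < hn (X x) + K * hn x by rewrite ltr_wpDr.
have /closure_seminormP/(_ (e / (hn (X x) + K * hn x))) := XM x.
case=> [|_ [[y _ <-] lt]]; first by rewrite divr_gt0.
move: lt; rewrite ltr_pdivlMr// => lt.
have -> : hn (X x) * hn (X x) = cabs (inn (X x) (X x - A y) + inn (X x) (A y)).
  by rewrite -(siDr hs) subrK (si_diag hs) cabsC ger0_norm ?sqr_ge0.
apply: (le_trans (cabsD _ _)).
have le1 := cauchy_schwarz hs (X x) (X x - A y).
have le2 := bound x y.
have le3 : hn (A y) <= hn (X x) + hn (X x - A y).
  by rewrite -{1}(subKr (X x) (A y)) -(seminormN hs (X x - A y)) (seminorm_triangle hs).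
have := ler_wpM2l k0 le3.
by move: le1 le2 lt; nra.
Qed.

(** A solution [y0] of [A y = T^* A x] may be replaced by its projection on the closure of
    the range of [A], because what is removed is orthogonal to that range, hence in
    the kernel of [A]. *)
Lemma sharpA_spec : [/\ bounded_operator (sharpA A T),
  A \o sharpA A T = adjoint T \o A & range (sharpA A T) `<=` closure (range A)].
Proof.
pose P := [set X | [/\ bounded_operator X, A \o X = adjoint T \o A
                     & range X `<=` closure (range A)]].
suff : P (get P) by [].
apply: getPex.
have lA := pA.1.1.
have [[lS _] _] := adjointP TA.1.
have /choice[X HX] x : exists y, M y /\ A y = adjoint T (A x).
  have [|y0 _ /= Ay0] := TA.2 (adjoint T (A x)); first by exists x.
  have [m [Mm orth]] := orthogonal_projection M0 M_lin M_closed y0.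
  exists m; split => //; rewrite -Ay0; apply: inn_ext => z.
  rewrite -!(positive_hermitian pA); apply/eqP; rewrite eq_sym -subr_eq0 -(siBr hs).
  rewrite (si_conj hs) orth ?rmorph0//.
  by apply: subset_closure; exists z.
have XM x : M (X x) by exact: (HX x).1.
have AX x : A (X x) = adjoint T (A x) by exact: (HX x).2.
have [K HK] := reduced_solution_bounded XM AX.
exists X; split.
- apply: (bounded_operator_intro _ HK) => a x y.
  apply/eqP; rewrite -subr_eq0; apply/eqP; apply: closure_range_ker0.
    by rewrite -scaleN1r [_ + -1 *: _]addrC; apply: M_lin => //; apply: M_lin.
  by rewrite (linear_mapB lA) lA !AX lA lS subrr.
- by apply/funext => x /=; rewrite AX.
- by move=> _ [x _ <-]; exact: XM.
Qed.

Lemma sharpA_adjoint_pair : adjoint_pair (innA A) T (sharpA A T).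
Proof.
move=> x y; have [_ /(congr1 (@^~ x)) /= e _] := sharpA_spec.
rewrite /innA e (si_conj hs) -(adjointP TA.1).2 -(si_conj hs) //.
Qed.

(** [||T x||_A^2 = <X T x, x>_A], and [X T] is symmetric for the semi-inner product of
    [A], so its boundedness in the norm passes to the seminorm. *)
Lemma BA_bounded_normA : exists K : R, forall x, normA A (T x) <= K * normA A x.
Proof.
have hA := positive_semi_inner pA.
have [bX _ _] := sharpA_spec.
have TX := sharpA_adjoint_pair.
have [KT [KT0 HT]] := bounded_operator_bound TA.1.
have [KX [KX0 HX]] := bounded_operator_bound bX.
have [KA [KA0 HAb]] := bounded_operator_bound pA.1.
exists (Num.sqrt (KX * KT)) => x.
have XTXT : adjoint_pair (innA A) (sharpA A T \o T) (sharpA A T \o T).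
  by move=> u v /=; rewrite TX (adjoint_pair_sym hA TX).
have hP y : hn ((sharpA A T \o T) y) <= KX * KT * hn y.
  by rewrite (le_trans (HX _))// -mulrA ler_pM2l.
have qh y : seminorm (innA A) y <= Num.sqrt KA * hn y.
  rewrite -(@ler_pXn2r _ 2) ?nnegrE ?mulr_ge0 ?sqrtr_ge0 ?seminorm_ge0//.
  rewrite exprMn (sqr_sqrtr (ltW KA0)).
  have -> : seminorm (innA A) y ^+ 2 = cabs (inn (A y) y).
    by rewrite -[inn (A y) y]/(innA A y y) (si_diag hA) cabsC ger0_norm ?sqr_ge0.
  apply: (le_trans (cauchy_schwarz hs _ _)).
  by rewrite expr2 mulrA ler_wpM2r ?seminorm_ge0.
have := krein_lax hA XTXT (mulr_gt0 KX0 KT0) hP (sqrtr_ge0 _) qh x.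
rewrite /= TX (si_diag hA) cabsC ger0_norm ?sqr_ge0// => le2.
rewrite -(@ler_pXn2r _ 2) ?nnegrE ?mulr_ge0 ?sqrtr_ge0//.
by rewrite exprMn (sqr_sqrtr (ltW (mulr_gt0 KX0 KT0))).
Qed.

End Douglas.

(** * The operator seminorm and the numerical radius as suprema *)

(** Passing from unit vectors to all vectors uses an a priori bound [c] twice: it makes
    [sup] an upper bound, and it settles the vectors of seminorm 0, which cannot be
    normalised. *)

Section Suprema.
Variable A : H -> H.
Hypothesis pA : positive_operator A.
Let hA := positive_semi_inner pA.

Lemma sup_of_ge0 (E : set R) : (forall r, E r -> 0 <= r) -> 0 <= sup E.
Proof.
move=> E0; have [hE|nE] := pselect (has_sup E); last by rewrite sup_out.
have [[r Er] ubE] := hE.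
by apply: (le_trans (E0 _ Er)); apply: ub_le_sup.
Qed.

Lemma opnormA_ge0 T : 0 <= opnormA A T.
Proof.
apply: sup_of_ge0 => _ [x _ <-]; exact: sqrtr_ge0.
Qed.

Lemma wA_ge0 T : 0 <= wA A T.
Proof. by apply: sup_of_ge0 => _ [x _ <-]; exact: cabs_ge0. Qed.

Lemma sup_image_le (f : H -> R) (c : R) : 0 <= c ->
  (forall x, normA A x = 1 -> f x <= c) ->
  sup [set f x | x in [set x | normA A x = 1]] <= c.
Proof.
move=> c0 fc; have [->|/set0P ne] := eqVneq [set f x | x in [set x | normA A x = 1]] set0.
  by rewrite sup0.
by apply: ge_sup => // _ [x /= x1 <-]; exact: fc.
Qed.

Lemma sup_image_ub (f : H -> R) (c : R) x : (forall x, normA A x = 1 -> f x <= c) ->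
  normA A x = 1 -> f x <= sup [set f x | x in [set x | normA A x = 1]].
Proof.
move=> fc x1; apply: ub_le_sup; last by exists x.
by exists c => _ [y /= y1 <-]; exact: fc.
Qed.

Lemma normA_cauchy_schwarz x y : cabs (innA A x y) <= normA A x * normA A y.
Proof. exact: cauchy_schwarz. Qed.

Lemma normAZ a x : normA A (a *: x) = cabs a * normA A x.
Proof. exact: seminormZ. Qed.

Lemma normalize x : normA A x != 0 ->
  exists u, normA A u = 1 /\ x = (normA A x)%:C *: u.
Proof.
move=> ne; exists ((normA A x)^-1%:C *: x); split.
  rewrite normAZ cabsC ger0_norm ?invr_ge0 ?sqrtr_ge0//.
  by rewrite mulVf.
by rewrite scalerA -rmorphM divff// scale1r.
Qed.

Lemma opnormA_bound T (c : R) : linear T ->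
  (forall x, normA A (T x) <= c * normA A x) ->
  forall x, normA A (T x) <= opnormA A T * normA A x.
Proof.
move=> lT Tc x; have [e|/normalize[u [u1 ->]]] := eqVneq (normA A x) 0.
  by have := Tc x; rewrite e !mulr0.
rewrite (linear_mapZ lT) !normAZ mulrCA.
rewrite ler_wpM2l ?cabs_ge0// u1 mulr1.
by apply: (@sup_image_ub (normA A \o T) c) => // y y1; have := Tc y; rewrite y1 mulr1.
Qed.

Lemma wA_bound T (c : R) : linear T ->
  (forall x, normA A (T x) <= c * normA A x) ->
  forall x, cabs (innA A (T x) x) <= wA A T * normA A x ^+ 2.
Proof.
move=> lT Tc x; have [e|/normalize[u [u1 ->]]] := eqVneq (normA A x) 0.
  by have := normA_cauchy_schwarz (T x) x; rewrite e expr0n !mulr0.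
rewrite (linear_mapZ lT) (siZl hA) (siZr hA) !cabsM cabsJ mulrA -expr2.
rewrite normAZ exprMn u1 expr1n mulr1 mulrC.
rewrite ler_wpM2r ?sqr_ge0//.
apply: (@sup_image_ub (fun x => cabs (innA A (T x) x)) c) => // y y1.
have := normA_cauchy_schwarz (T y) y; rewrite y1 mulr1 => /le_trans; apply.
by have := Tc y; rewrite y1 mulr1.
Qed.

End Suprema.

(** * Commutators and squares *)

Lemma wA_commutator_bound A T S (e : R[i]) : positive_operator A -> BA A T -> BA A S ->
  cabs e = 1 ->
  wA A ((T \o S) + e *: (S \o T)) <= 2 * Num.sqrt 2 * opnormA A S *
    Num.sqrt (wA A T ^+ 2 - `|opnormA A (ReA A T) ^+ 2 - opnormA A (ImA A T) ^+ 2| / 2).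
Proof.
move=> pA TA SA e1.
have hA := positive_semi_inner pA.
have [[lX _] _ _] := sharpA_spec pA TA.
have TX := sharpA_adjoint_pair pA TA.
have [cT HT] := BA_bounded_normA pA TA.
have [cS HS] := BA_bounded_normA pA SA.
have lT := TA.1.1; have lS := SA.1.1.
have Tw := wA_bound pA lT HT.
have Bw := re_part_bound hA lT lX TX Tw.
have Cw := im_part_bound hA lT lX TX Tw.
have lB := linear_re_part lT lX.
have lC := linear_im_part lT lX.
have w0 := wA_ge0 A T.
apply: sup_image_le => [|x x1].
  by rewrite !mulr_ge0 ?sqrtr_ge0 ?opnormA_ge0.
apply: (commutator_bound hA TX e1 (opnormA_ge0 _ _)) => //.
- exact: opnormA_bound HS.
- by have := opnormA_bound pA lB Bw x; rewrite x1 mulr1.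
- by have := opnormA_bound pA lC Cw x; rewrite x1 mulr1.
- by apply: sup_image_le => // y y1; have := Bw y; rewrite [seminorm _ y]y1 mulr1.
- by apply: sup_image_le => // y y1; have := Cw y; rewrite [seminorm _ y]y1 mulr1.
Qed.

End Operators.

Theorem corollary3p7 (R : realType) (H : hilbertType R) (A T S : H -> H)
    (hA : positive_operator A) (hT : BA A T) (hS : BA A S) :
  let rad := Num.sqrt (wA A T ^+ 2 -
    `|opnormA A (ReA A T) ^+ 2 - opnormA A (ImA A T) ^+ 2| / 2) in
  [/\ wA A ((T \o S) + (S \o T)) <= 2 * Num.sqrt 2 * opnormA A S * rad,
      wA A ((T \o S) - (S \o T)) <= 2 * Num.sqrt 2 * opnormA A S * rad
    & wA A (T \o T) <= Num.sqrt 2 * opnormA A T * rad].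
Proof.
move=> rad; split.
- have := wA_commutator_bound hA hT hS (e := 1).
  by rewrite scale1r /cabs normr1; apply.
- have := wA_commutator_bound hA hT hS (e := -1).
  by rewrite scaleN1r /cabs normrN1; apply.
have := wA_commutator_bound hA hT hT (e := 1).
rewrite scale1r {1}/cabs normr1 => /(_ erefl); rewrite -/rad => le2.
(* T \o T + T \o T is twice T \o T, whose numerical radius is a finite supremum *)
suff two : 2 * wA A (T \o T) <= wA A ((T \o T) + (T \o T)).
  by move: (le_trans two le2); lra.
have sA := positive_semi_inner hA.
have [c Hc] := BA_bounded_normA hA hT.
have cc x : normA A (T (T x)) <= (`|c| * `|c|) * normA A x.
  have H1 y : normA A (T y) <= `|c| * normA A y.
    by apply: (le_trans (Hc y)); rewrite ler_wpM2r ?ler_norm ?sqrtr_ge0.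
  by apply: (le_trans (H1 _)); rewrite -mulrA ler_wpM2l.
have twice x : cabs (innA A (((T \o T) + (T \o T)) x) x) = 2 * cabs (innA A (T (T x)) x).
  rewrite -[(_ + _) x]/(T (T x) + T (T x)) -mulr2n -scaler_nat (siZl sA) cabsM.
  by rewrite /cabs normr_nat.
rewrite mulrC -ler_pdivlMr//; apply: sup_image_le => [|x x1].
  by rewrite divr_ge0// wA_ge0.
rewrite ler_pdivlMr// mulrC -twice.
apply: (@sup_image_ub _ _ _ (fun x => cabs (innA A (((T \o T) + (T \o T)) x) x))
  (2 * (`|c| * `|c|))) => // y y1.
rewrite twice ler_pM2l//.
have := normA_cauchy_schwarz hA (T (T y)) y; rewrite y1 mulr1 => /le_trans; apply.
by have := cc y; rewrite y1 mulr1.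
Qed.
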